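(* $\beta(\mathbb{Z}_2 \times \mathbb{Z}_4) = 14$.
   Context: All posets are finite and non-empty. For a poset $P$, $\operatorname{Aut}(P)$ is the group of order-automorphisms of $P$ (bijections $P \to P$ that preserve the order and whose inverse preserves the order). For a finite group $G$, $\beta(G) := \min\{\,|P| : P \text{ is a finite non-empty poset with } \operatorname{Aut}(P) \cong G\,\}$. $\mathbb{Z}_n$ denotes the cyclic group of order $n$. *)

(* Defs.v *)
From mathcomp Require Import all_boot all_order all_algebra all_fingroup.
From mathcomp Require Import boolp classical_sets.
Set Implicit Arguments.
Unset Strict Implicit.
Unset Printing Implicit Defensive.
Import Order.Theory.

Local Open Scope group_scope.

Section PosetAut.
Variables (d : Order.disp_t) (P : finPOrderType d).

Definition order_preserving (s : {perm P}) : bool :=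
  [forall x, forall y, (x <= y)%O ==> (s x <= s y)%O].

Definition poset_aut : {set {perm P}} :=
  [set s | order_preserving s && order_preserving s^-1].

Lemma order_preservingP (s : {perm P}) :
  reflect {homo s : x y / (x <= y)%O} (order_preserving s).
Proof.
apply: (iffP forallP) => [h x y lexy | h x].
  by have /forallP/(_ y)/implyP := h x; apply.
by apply/forallP => y; apply/implyP => /h.
Qed.

Lemma group_set_poset_aut : group_set poset_aut.
Proof.
have opM s t :
    order_preserving s -> order_preserving t -> order_preserving (s * t).
  move=> /order_preservingP hs /order_preservingP ht.
  by apply/order_preservingP => x y /hs /ht; rewrite !permM.
apply/group_setP; split=> [|s t].
  by rewrite inE invg1 andbb; apply/order_preservingP => x y; rewrite !perm1.
by rewrite !inE invMg => /andP[s1 s2] /andP[t1 t2]; rewrite !opM.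
Qed.

Canonical poset_aut_group := Group group_set_poset_aut.

End PosetAut.

Arguments poset_aut {d} P.

Section Beta.
Variables (gT : finGroupType) (G : {group gT}).

Definition aut_poset_cards : set nat :=
  [set n | exists (d : Order.disp_t) (P : finPOrderType d),
     [/\ (0 < #|P|)%N, poset_aut P \isog G & n = #|P|]]%classic.

(* The minimum of [aut_poset_cards]. The default value 0 is taken only if that
   set is empty, since the posets are nonempty; see [betaE]. *)
Definition beta : nat :=
  xget 0%N [set n | aut_poset_cards n /\
                    forall m, aut_poset_cards m -> (n <= m)%N]%classic.

Lemma betaE (n : nat) : (0 < n)%N ->
  beta = n <-> aut_poset_cards n /\
               (forall m, aut_poset_cards m -> (n <= m)%N).
Proof.
move=> n_gt0; rewrite /beta; split=> [|[An minn]].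
  by case: xgetP => [m _ [Am minm] <- // | _ n0]; rewrite -n0 in n_gt0.
apply: xget_unique => [|m [Am minm]]; first by split.
by apply/eqP; rewrite eqn_leq minn ?minm.
Qed.

End Beta.

(* Main.v *)
Require Import Defs.
From mathcomp Require Import all_boot all_order all_algebra all_fingroup.
From HB Require Import structures.

Set Implicit Arguments.
Unset Strict Implicit.
Unset Printing Implicit Defensive.
Import Order.Theory.

Local Open Scope group_scope.

(** Write Z_2 x Z_4 = <a> x <b>, and let it be the whole automorphism group A
of a finite poset P. Two facts drive the lower bound 14 <= #|P|.

Orbits are antichains, and A is abelian, so A acts on each orbit through a
regular quotient. If two points x and k x (k in A) of an orbit with at least
three points had the same strict relations to all points outside the orbit,
then the transposition of x and k x would be an automorphism that does not
commute with A. So every such pair is told apart by a point outside the orbit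
([separating_point]), and that point is moved by every h in A with h x = k x.
Hence orbits of certain kinds force the existence of others, and the sizes of
distinct orbits add up to at most #|P| ([orbit_sizes_le13]).

Suppose #|P| <= 13. Counting excludes regular orbits, so the orbit of a point x
moved by b^2 is a 4-cycle of b, and its stabilizer is <a> or <a b^2>
([no_regular_orbit]). Both stabilizers cannot occur, for each would need two
4-cycles ([stabilizer_type_unique]). Up to replacing a by a b^2, all points
moved by b^2 are thus fixed by a; there are exactly two 4-cycles, say x_i < y_j
iff j - i belongs to a subset S of Z_4 that contains 0 and not 2. The other
points are fixed by b^2, so that a 4-cycle sees them only through the parity of
its indices. Every subset S of Z_4 with these properties has a reflection
j -> c - j, and so the reflections x_i -> x_(e-i), y_j -> y_(f-j), where
f - e = c, preserve the relation between the two cycles. If c is even then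
e = f = 0 preserves parities, and the reflection extended by the identity is an
automorphism that does not commute with b ([reflection_absurd]). If c is odd,
exactly one of the two cycles has its parities exchanged, and e may be chosen to
make it either one; the reflection still extends unless both cycles are related
to the remaining points in a way that depends on parity. There are at most five
remaining points, which must include a point moved by a, so counting shows that
one and the same orbit {z, b z} (or larger) would be linked to both cycles;
transitivity of the order rules this out ([not_both_linked]).

For the upper bound, take x_i < y_i < z_i and x_i < z_(i+1) for i in Z_4, with
two incomparable points above everything. Automorphisms preserve the four
levels, they permute the three 4-point levels in the same way because of
x_i < y_i < z_i, and x_i < z_(i+1) forces that permutation to be a rotation
([poset14_autE]). *)

(** * Automorphisms of a poset and their orbits *)

Section PosetAutomorphisms.
Variables (d : Order.disp_t) (P : finPOrderType d).
Implicit Types (x y z : P) (g h k s : {perm P}).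

Local Notation A := (poset_aut P).
Local Notation orb := (orbit 'P A).

Lemma poset_aut_lt s x y : s \in A -> (s x < s y)%O = (x < y)%O.
Proof.
rewrite inE => /andP[/order_preservingP hs /order_preservingP hV].
rewrite !lt_neqAle (inj_eq perm_inj); congr (_ && _).
by apply/idP/idP => [/hV | /hs //]; rewrite !permK.
Qed.

Lemma mem_poset_aut s : {mono s : x y / (x < y)%O} -> s \in A.
Proof.
move=> hs.
have le_s x y : (s x <= s y)%O = (x <= y)%O.
  by rewrite !le_eqVlt hs (inj_eq perm_inj).
rewrite inE; apply/andP; split; apply/order_preservingP => x y.
  by rewrite le_s.
by rewrite -{1}(permKV s x) -{1}(permKV s y) le_s.
Qed.

(** Iterating x < g x would give x < g^n x for all n > 0, in particular for n the
order of g. *)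
Lemma poset_aut_antichain g x : g \in A -> (x < g x)%O = false.
Proof.
move=> gA; apply/negP => lt_xg.
have up n : (x < (g ^+ n.+1) x)%O.
  elim: n => [|n IHn]; first by rewrite expg1.
  rewrite expgS permM; apply: lt_trans lt_xg _.
  by rewrite -permM -expgS expgSr permM poset_aut_lt.
have := up #[g].-1; rewrite prednK ?order_gt0 // expg_order perm1.
by rewrite ltxx.
Qed.

Lemma mem_orb g x : g \in A -> g x \in orb x.
Proof. exact: mem_orbit. Qed.

Lemma lt_notin_orb x y : (x < y)%O -> y \notin orb x.
Proof.
move=> lt_xy; apply/negP => /orbitP[g gA /= def_y].
by move: lt_xy; rewrite -def_y /aperm poset_aut_antichain.
Qed.

Lemma orb_antichain x y z : y \in orb x -> z \in orb x -> (y < z)%O = false.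
Proof.
move=> yx zx; apply/negP => /lt_notin_orb/negP; apply.
by move/orbit_eqP: yx => ->.
Qed.

(** The orbits partition P. *)
Lemma sum_card_orb (s : seq P) :
  uniq (map orb s) -> \sum_(x <- s) #|orb x| <= #|P|.
Proof.
move=> Us; rewrite -(big_map orb xpredT (fun B : {set P} => #|B|)).
have actsA : [acts A, on [set: P] | 'P].
  by apply/actsP => g gA x; rewrite !inE.
rewrite -[#|P|]cardsT (card_partition (orbit_partition actsA)).
rewrite big_uniq //= [leqRHS](bigID (mem (map orb s))) /=.
apply: leq_trans (leq_addr _ _).
rewrite [leqLHS](eq_bigl (fun B => (B \in orb @: [set: P])
                                    && (B \in map orb s))) // => B.
rewrite andb_idl // => /mapP[x _ ->]; exact: imset_f.
Qed.

Lemma card_orb_ge (gs : seq {perm P}) x :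
  {subset gs <= A} -> uniq [seq g x | g : {perm P} <- gs] -> size gs <= #|orb x|.
Proof.
move=> gsA Ugs; rewrite -(size_map (fun g : {perm P} => g x)) -(card_uniqP Ugs).
by apply/subset_leq_card/subsetP => _ /mapP[g /gsA gA ->]; apply: mem_orb.
Qed.

(** * Orbits of an abelian automorphism group *)

Hypothesis abA : abelian A.

Lemma poset_autC g h x : g \in A -> h \in A -> g (h x) = h (g x).
Proof. by move=> gA hA; rewrite -!permM (centsP abA). Qed.

Lemma fix_orb g x y : g \in A -> y \in orb x -> (g y == y) = (g x == x).
Proof.
move=> gA /orbitP[h hA <-] /=; rewrite /aperm poset_autC //.
by rewrite (inj_eq perm_inj).
Qed.

(** Were there no such z, the transposition of x and k x would be an automorphism:
inside the orbit there is no relation to preserve. Since g x is neither x nor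
k x, this transposition does not commute with g. *)
Lemma separating_point k g x :
    k \in A -> g \in A -> k x != x -> g x != x -> g x != k x ->
  exists2 z, z \notin orb x
    & (k x < z)%O != (x < z)%O \/ (z < k x)%O != (z < x)%O.
Proof.
move=> kA gA kx gx gkx.
case: (pickP (fun z => (z \notin orb x) &&
   (((k x < z)%O != (x < z)%O) || ((z < k x)%O != (z < x)%O)))) => [z|twins].
  by case/andP=> zx /orP sep; exists z.
have twin z : (k x < z)%O = (x < z)%O /\ (z < k x)%O = (z < x)%O.
  have [zx | zx] := boolP (z \in orb x).
    by rewrite !(orb_antichain (x := x)) // ?mem_orb ?orbit_refl.
  by have := twins z; rewrite zx /= => /norP[/negPn/eqP-> /negPn/eqP->].
have tL u v : (tperm x (k x) u < v)%O = (u < v)%O.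
  by case: tpermP => [->|->|] //; rewrite (twin v).1.
have tR u v : (v < tperm x (k x) u)%O = (v < u)%O.
  by case: tpermP => [->|->|] //; rewrite (twin v).2.
have tA : tperm x (k x) \in A by apply: mem_poset_aut => u v; rewrite tL tR.
have := poset_autC x tA gA; rewrite tpermL tpermD 1?eq_sym // => /perm_inj.
by move/esym/eqP; rewrite (negPf kx).
Qed.

(** The converse constraint: a point separating x from h x is moved by h. *)
Lemma fix_lt h x z :
  h \in A -> h z = z -> (h x < z)%O = (x < z)%O /\ (z < h x)%O = (z < x)%O.
Proof. by move=> hA hz; rewrite -{1 3}hz !poset_aut_lt. Qed.

(** * Two commuting automorphisms of orders 2 and 4 *)

Variables (a b : {perm P}).
Hypotheses (aA : a \in A) (bA : b \in A).
Hypotheses (a2 : forall x, a (a x) = x) (b4 : forall x, b (b (b (b x))) = x).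

Local Lemma abC x : a (b x) = b (a x).
Proof. exact: poset_autC. Qed.

Lemma card_orb_moved g x : g \in A -> g x != x -> 2 <= #|orb x|.
Proof.
move=> gA gx; apply: (@card_orb_ge [:: 1; g]) => [h|].
  by move: h; apply/allP; rewrite /= group1 gA.
by rewrite /= inE perm1 eq_sym gx.
Qed.

Lemma cycle4_neq x : b (b x) != x ->
  [/\ b x != x, b (b (b x)) != x & b (b (b x)) != b x].
Proof.
move=> bbx; split.
- by apply: contra bbx => /eqP bx; rewrite !bx.
- by apply: contra bbx => /eqP b3x; move: (b4 x); rewrite b3x => bx; rewrite !bx.
- by rewrite (inj_eq perm_inj).
Qed.

Lemma card_orb_cycle4 x : b (b x) != x -> 4 <= #|orb x|.
Proof.
move=> bbx; have [bx b3x b31x] := cycle4_neq bbx.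
apply: (@card_orb_ge [:: 1; b; b * b; b * b * b]).
  by apply/allP; rewrite /= group1 bA !groupM.
rewrite /= !permM perm1 !inE /= !negb_or !(inj_eq perm_inj).
by rewrite !(eq_sym x) bx bbx b3x.
Qed.

Lemma card_orb_regular x :
  b (b x) != x -> a x != x -> a x != b (b x) -> 8 <= #|orb x|.
Proof.
move=> bbx ax abbx; have [bx b3x b31x] := cycle4_neq bbx.
have abx : a x != b x.
  by apply: contra bbx => /eqP ax_bx; rewrite -ax_bx -abC -ax_bx a2.
have ab3x : a x != b (b (b x)).
  apply: contra bbx => /eqP ax_b3x.
  by have := a2 x; rewrite ax_b3x !abC ax_b3x b4 => ->.
apply: (@card_orb_ge [:: 1; b; b * b; b * b * b;
                       a; a * b; a * (b * b); a * (b * b * b)]).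
  by apply/allP; rewrite /= group1 bA aA !groupM.
have inv u v : (u == b v) = (b (b (b u)) == v).
  by rewrite -{1}(b4 u) (inj_eq perm_inj).
have invx v : (x == a v) = (a x == v) by rewrite -{1}(a2 x) (inj_eq perm_inj).
rewrite /= !permM perm1 !inE /= !negb_or !inv !b4 !(eq_sym _ (a x)).
rewrite -!abC !(inj_eq perm_inj) !(eq_sym x).
by rewrite bx bbx b3x ax abx abbx ab3x.
Qed.

Lemma orb_eqE x y : (orb x == orb y) = (x \in orb y).
Proof. exact/eqP/orbit_eqP. Qed.

Lemma notin_orb_fix g x y :
  g \in A -> g x != x -> g y == y -> x \notin orb y /\ y \notin orb x.
Proof.
move=> gA gx gy; split; apply/negP => /(fix_orb gA).
  by rewrite gy (negPf gx).
by rewrite gy (negPf gx).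
Qed.

(** A 4-cycle of b cannot stand alone: a point separating x from b^2 x is moved by
b^2, and so lies on another 4-cycle. *)
Lemma separated_by_b2 x : b (b x) != x ->
  exists2 z, (z \notin orb x) && (b (b z) != z)
    & (b (b x) < z)%O != (x < z)%O \/ (z < b (b x))%O != (z < x)%O.
Proof.
move=> bbx; have [bx _ _] := cycle4_neq bbx.
have b2A : b * b \in A by rewrite groupM.
have [|||z zx sep] := @separating_point (b * b) b x b2A bA; rewrite ?permM //.
  by rewrite (inj_eq perm_inj) eq_sym.
rewrite !permM in sep; exists z => //; rewrite zx.
apply/negP => /eqP bbz; have := @fix_lt (b * b) x z b2A; rewrite !permM.
by case=> // lt1 lt2; rewrite lt1 lt2 !eqxx in sep; case: sep.
Qed.

(** * Consequences of having at most 13 points *)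

Hypothesis le13 : #|P| <= 13.

Lemma orbit_sizes_le13 (s : seq P) (ns : seq nat) :
    all2 (fun n x => n <= #|orb x|) ns s -> uniq (map orb s) ->
  sumn ns <= 13.
Proof.
move=> le_ns /sum_card_orb/leq_trans/(_ le13); apply: leq_trans.
elim: s ns le_ns => [|x s IHs] [|n ns] //=.
by case/andP=> le_n /IHs le_ns; rewrite big_cons leq_add.
Qed.

(** Next to a regular orbit there are at most 5 points, which is too few for a
faithful action of <a> x <b>: some involution k acts trivially on them, and then
nothing separates x from k x. *)
Lemma no_regular_orbit x : b (b x) != x -> (a x == x) || (a x == b (b x)).
Proof.
move=> bbx; apply/negPn; rewrite negb_or; apply/negP => /andP[ax abbx].
have [bx _ _] := cycle4_neq bbx.
have o8 := card_orb_regular bbx ax abbx.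
have [k [kA kx bkx kfix]] : exists k,
    [/\ k \in A, k x != x, b x != k x & forall z, z \notin orb x -> k z = z].
  case: (pickP (fun y => (y \notin orb x) && (b (b y) != y))) => [y|fixb].
    case/andP=> yx bby; have o4 := card_orb_cycle4 bby.
    have kfix k : k \in A -> k y == y -> forall z, z \notin orb x -> k z = z.
      move=> kA ky z zx; apply/eqP/negPn/negP => kz.
      have o2 := card_orb_moved kA kz.
      have [_ zy] := notin_orb_fix kA kz ky.
      have /orbit_sizes_le13 : all2 (fun n u => n <= #|orb u|) [:: 8; 4; 2] [:: x; y; z].
        by rewrite /= o8 o4 o2.
      by rewrite /= !inE !orb_eqE negb_or zy !(orbit_sym _ _ x) yx zx => /(_ isT).
    have [ay | ay] := boolP (a y == y).
      exists a; split=> //; last exact: kfix.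
      by apply: contra bbx => /eqP bx_ax; rewrite bx_ax -abC bx_ax a2.
    have [aby | aby] := boolP (a y == b (b y)).
      have kA : a * (b * b) \in A by rewrite !groupM.
      exists (a * (b * b)); split; rewrite ?permM //.
      - by rewrite -(inj_eq (@perm_inj _ b)) -(inj_eq (@perm_inj _ b)) b4.
      - apply: contra bbx => /eqP /perm_inj xbax.
        have ax_bx : a x = b x by rewrite {1}xbax abC a2.
        by rewrite -ax_bx -xbax.
      by apply: kfix; rewrite // !permM (eqP aby) b4.
    have o8' := card_orb_regular bby ay aby.
    have /orbit_sizes_le13 : all2 (fun n u => n <= #|orb u|) [:: 8; 8] [:: x; y].
      by rewrite /= o8 o8'.
    by rewrite /= !inE !orb_eqE orbit_sym yx => /(_ isT).
  exists (b * b); split; rewrite ?groupM ?permM //.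
    by rewrite (inj_eq perm_inj) eq_sym.
  by move=> z zx; rewrite permM; have := fixb z; rewrite zx /= => /negPn/eqP.
have [z zx] := separating_point kA bA kx bx bkx.
by have [-> ->] := fix_lt x kA (kfix z zx); rewrite !eqxx => -[].
Qed.

(** A point separating x1 from b^2 x1 = a b^2 x1 is moved by a b^2 as well as by
b^2, so its stabilizer is again <a>; in the same way x2 comes with a second
orbit of its own type, and this makes 16 points. *)
Lemma stabilizer_type_unique x1 x2 :
    b (b x1) != x1 -> b (b x2) != x2 ->
  a x1 = x1 -> a x2 = b (b x2) -> False.
Proof.
move=> bbx1 bbx2 ax1 ax2.
have abbA : a * (b * b) \in A by rewrite !groupM.
have [z1 /andP[z1x1 bbz1] sep1] := separated_by_b2 bbx1.
have [z2 /andP[z2x2 bbz2] sep2] := separated_by_b2 bbx2.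
have az1 : a z1 == z1.
  case/orP: (no_regular_orbit bbz1) => // /eqP abz1.
  have := @fix_lt _ x1 z1 abbA; rewrite !permM ax1 abz1 b4.
  by case=> // lt1 lt2; rewrite lt1 lt2 !eqxx in sep1; case: sep1.
have az2 : a z2 == b (b z2).
  case/orP: (no_regular_orbit bbz2) => // /eqP az2.
  have := @fix_lt _ x2 z2 aA az2; rewrite ax2.
  by case=> // lt1 lt2; rewrite lt1 lt2 !eqxx in sep2; case: sep2.
have am2 u : b (b u) != u -> a u == b (b u) -> a u != u.
  by move=> ? /eqP->.
have ax1' : a x1 == x1 by rewrite ax1.
have ax2' : a x2 != x2 by rewrite ax2.
have [x2x1 x1x2] := notin_orb_fix aA ax2' ax1'.
have [x2z1 z1x2] := notin_orb_fix aA ax2' az1.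
have [z2x1 x1z2] := notin_orb_fix aA (am2 _ bbz2 az2) ax1'.
have [z2z1 z1z2] := notin_orb_fix aA (am2 _ bbz2 az2) az1.
have /orbit_sizes_le13 :
    all2 (fun n u => n <= #|orb u|) [:: 4; 4; 4; 4] [:: x1; z1; x2; z2].
  by rewrite /= !card_orb_cycle4.
rewrite /= !inE !orb_eqE !negb_or x1x2 x1z2 z1x2 z1z2.
by rewrite (orbit_sym _ _ x1) z1x1 (orbit_sym _ _ x2) z2x2 => /(_ isT).
Qed.

(** * Reflecting a pair of 4-cycles *)

Lemma iter_mod4 i x : iter (i %% 4) b x = iter i b x.
Proof.
rewrite {2}(divn_eq i 4) addnC iterD iterM; congr iter.
by rewrite iter_fix //= b4.
Qed.

Lemma eq_iter_mod4 i j x : i = j %[mod 4] -> iter i b x = iter j b x.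
Proof. by rewrite -(iter_mod4 i) => ->; rewrite iter_mod4. Qed.

Lemma iter_inj_mod4 i j x : b (b x) != x ->
  iter i b x = iter j b x -> i = j %[mod 4].
Proof.
move=> bbx; have [bx b3x b31x] := cycle4_neq bbx.
rewrite -(iter_mod4 i) -(iter_mod4 j) => /eqP.
have := ltn_pmod i (isT : 0 < 4); have := ltn_pmod j (isT : 0 < 4).
case: (i %% 4) (j %% 4) => [|[|[|[|//]]]] [|[|[|[|//]]]] _ _ //=;
  rewrite ?(inj_eq perm_inj) ?(eq_sym x) ?(negPf bx) ?(negPf bbx) ?(negPf b3x) //.
all: by rewrite ?(negPf b31x) // eq_sym ?(negPf b31x).
Qed.

Lemma iter_poset_aut i : exists2 h, h \in A & forall x, h x = iter i b x.
Proof. by exists (b ^+ i) => [|x]; rewrite ?groupX // permX. Qed.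

Lemma lt_iter i j x y : (iter i b x < iter j b y)%O = (x < iter (j + 3 * i) b y)%O.
Proof.
have [h hA hE] := iter_poset_aut (3 * i).
rewrite -[LHS](poset_aut_lt _ _ hA) !hE -!iterD (addnC j); congr (_ < _)%O.
by rewrite addnC -mulSn mulnC iterM iter_fix //= b4.
Qed.

(** A point fixed by b^2 is related in the same way to u and to b^2 u, so it sees
the cycle of u only through the parity of the index. *)
Lemma lt_fix_parity i j u z : odd i = odd j -> b (b z) = z ->
  (iter i b u < z)%O = (iter j b u < z)%O /\ (z < iter i b u)%O = (z < iter j b u)%O.
Proof.
move=> oij bbz.
have b2A : b * b \in A by rewrite groupM.
have red (k : nat) : (iter k b u < z)%O = (iter (odd k) b u < z)%O
          /\ (z < iter k b u)%O = (z < iter (odd k) b u)%O.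
  elim: k {-2}k (leqnn k) => [|n IHn] [|[|k]] // /ltnW le_kn.
  have := @fix_lt _ (iter k b u) z b2A; rewrite !permM => /(_ bbz) /= [-> ->].
  by rewrite negbK; apply: IHn.
by have [-> ->] := red i; have [-> ->] := red j; rewrite oij.
Qed.

(** For z fixed by b^2, this says that z distinguishes the even from the odd points
of the cycle of u. *)
Definition parity_link u z :=
  ((b u < z)%O != (u < z)%O) || ((z < b u)%O != (z < u)%O).

(** Only points fixed by b^2 count: a relation between two 4-cycles may depend on
more than parities, and is handled apart. *)
Definition linked u := [exists z, (b (b z) == z) && parity_link u z].

Lemma unlinked_lt i u z : ~~ linked u -> b (b z) = z ->
  (iter i b u < z)%O = (u < z)%O /\ (z < iter i b u)%O = (z < u)%O.
Proof.
rewrite negb_exists => /forallP unl bbz.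
have := unl z; rewrite bbz eqxx negb_or !negbK => /andP[/eqP l1 /eqP l2].
have [-> ->] := @lt_fix_parity i (odd i) u z (esym (oddb _)) bbz.
by case: (odd i).
Qed.

(** The map sending b^i x to b^(e-i) x and b^j y to b^(f-j) y, and fixing all other
points, would be an automorphism that does not commute with b. Since indices
matter modulo 4, - i is written 3 * i; the first hypothesis on e and f is the
symmetry j -> (f - e) - j of the relation between the two cycles. A shift e or f
that is odd exchanges parities, which is harmless only on an unlinked cycle. *)
Lemma reflection_absurd e f x y :
    b (b x) != x -> b (b y) != y -> (x < y)%O ->
    (forall z, b (b z) != z -> exists i, z = iter i b x \/ z = iter i b y) ->
    (forall j, (x < iter j b y)%O = (x < iter (f + 3 * e + 3 * j) b y)%O) ->
    (odd e -> ~~ linked x) -> (odd f -> ~~ linked y) ->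
  False.
Proof.
move=> bbx bby lt_xy coverM symS unlx unly.
have iter_orb u i : iter i b u \in orb u.
  by have [h hA <-] := iter_poset_aut i; apply: mem_orb.
have yx i j : iter i b y = iter j b x -> False.
  move=> eq_yx; have := lt_notin_orb lt_xy; rewrite orbit_sym => /negP; apply.
  move: (iter_orb y i); rewrite eq_yx => /orbit_eqP <-.
  by rewrite orbit_sym; apply: iter_orb.
have fixnx u i z : b (b u) != u -> b (b z) = z -> iter i b u <> z.
  move=> bbu bbz def_z; have b2A : b * b \in A by rewrite groupM.
  by have := fix_orb b2A (iter_orb u i); rewrite def_z !permM bbz eqxx (negPf bbu).
pose s z := if [pick i : 'I_4 | iter i b x == z] is Some i then iter (e + 3 * i) b x
  else if [pick i : 'I_4 | iter i b y == z] is Some i then iter (f + 3 * i) b y else z.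
have sx i : s (iter i b x) = iter (e + 3 * i) b x.
  rewrite /s; case: pickP => [j /eqP/(iter_inj_mod4 bbx) ji | /(_ (inord (i %% 4)))].
    by apply: eq_iter_mod4; rewrite -modnDmr -modnMmr ji modnMmr modnDmr.
  by rewrite inordK ?ltn_pmod // iter_mod4 eqxx.
have sy i : s (iter i b y) = iter (f + 3 * i) b y.
  rewrite /s; case: pickP => [j /eqP/esym/yx // | _].
  case: pickP => [j /eqP/(iter_inj_mod4 bby) ji | /(_ (inord (i %% 4)))].
    by apply: eq_iter_mod4; rewrite -modnDmr -modnMmr ji modnMmr modnDmr.
  by rewrite inordK ?ltn_pmod // iter_mod4 eqxx.
have sF z : b (b z) = z -> s z = z.
  move=> bbz; rewrite /s; case: pickP => [j /eqP/(fixnx _ _ _ bbx bbz) // | _].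
  by case: pickP => [j /eqP/(fixnx _ _ _ bby bbz) // | _].
have mod4 (k i : nat) : k + 3 * (k + 3 * i) = i %[mod 4].
  rewrite mulnDr mulnA addnA -mulSn -[(3 * 3)%N]/(4 * 2 + 1)%N mulnDl mul1n addnA.
  by rewrite -mulnA -mulnDr mulnC modnMDl.
have caseP z : b (b z) = z \/ exists i, z = iter i b x \/ z = iter i b y.
  by have [|/coverM] := eqVneq (b (b z)) z; [left | right].
have sK : involutive s.
  move=> z; case: (caseP z) => [Fz | [i [->|->]]]; first by rewrite !(sF z Fz).
    by rewrite !sx; apply: eq_iter_mod4.
  by rewrite !sy; apply: eq_iter_mod4.
have sE : perm (inv_inj sK) =1 s by move=> z; rewrite permE.
have lt_yx i j : (iter i b y < iter j b x)%O = false.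
  have [h hA hE] := iter_poset_aut i; apply/negP => lt_yx.
  have : (iter i b x < iter j b x)%O.
    by apply: lt_trans lt_yx; rewrite -!hE poset_aut_lt.
  by rewrite (orb_antichain (iter_orb _ _) (iter_orb _ _)).
have par (k : nat) u i z : (odd k -> ~~ linked u) -> b (b z) = z ->
    (iter (k + 3 * i) b u < z)%O = (iter i b u < z)%O
 /\ (z < iter (k + 3 * i) b u)%O = (z < iter i b u)%O.
  move=> unlk bbz; have [/unlk unl | evk] := boolP (odd k).
    have [-> ->] := @unlinked_lt (k + 3 * i) u z unl bbz.
    by have [-> ->] := @unlinked_lt i u z unl bbz.
  apply: lt_fix_parity => //.
  by rewrite oddD oddM (negPf evk).
have sA : perm (inv_inj sK) \in A.
  apply: mem_poset_aut => u v; rewrite !sE.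
  case: (caseP u) => [Fu | [i [->|->]]]; case: (caseP v) => [Fv | [j [->|->]]];
    rewrite ?(sF u) ?(sF v) ?sx ?sy //.
  - exact: (par _ _ _ _ unlx Fu).2.
  - exact: (par _ _ _ _ unly Fu).2.
  - exact: (par _ _ _ _ unlx Fv).1.
  - by rewrite !(orb_antichain (x := x)).
  - by rewrite !lt_iter [RHS]symS !mulnDr addnACA.
  - exact: (par _ _ _ _ unly Fv).1.
  - by rewrite !lt_yx.
  - by rewrite !(orb_antichain (x := y)).
have sx1 : s (b x) = iter (e + 3) b x := sx 1%N.
have sx0 : s x = iter e b x by rewrite -[e]addn0 -(sx 0%N).
have := poset_autC x sA bA; rewrite !sE sx1 sx0 -iterS.
by move/(iter_inj_mod4 bbx)/eqP; rewrite -[e.+1]addn1 eqn_modDl.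
Qed.

Lemma lt_bb u v : (b (b u) < v)%O = (u < b (b v))%O.
Proof. by rewrite -2![LHS](poset_aut_lt _ _ bA) b4. Qed.

(** The point separating x from b^2 x lies on another 4-cycle, above or below that
of x; up to exchanging the cycles and shifting by b^2, it is above. *)
Lemma exists_comparable_cycles x : b (b x) != x ->
  exists u v, [/\ b (b u) != u, b (b v) != v, (u < v)%O & ~~ (b (b u) < v)%O].
Proof.
move=> bbx; have [z /andP[_ bbz] sep] := separated_by_b2 bbx.
have bbbbx : b (b (b (b x))) != b (b x) by rewrite !(inj_eq perm_inj).
have bbbbz : b (b (b (b z))) != b (b z) by rewrite !(inj_eq perm_inj).
case: sep; rewrite ?lt_bb.
  case: (boolP (x < z)%O) => xz; case: (boolP (x < b (b z))%O) => // xbbz _.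
    by exists x, z; split; rewrite ?lt_bb.
  by exists x, (b (b z)); split; rewrite // lt_bb b4.
rewrite -lt_bb.
case: (boolP (z < x)%O) => zx; case: (boolP (b (b z) < x)%O) => // bbzx _.
  by exists z, x.
by exists (b (b z)), x; rewrite b4 eq_sym.
Qed.

(** * Points that see the parity of a 4-cycle *)

(** Both b and a b advance the cycle of u by one step, so a point that sees parities
can be fixed by neither. *)
Lemma parity_link_moved u z :
  a u = u -> b (b z) = z -> parity_link u z -> b z != z /\ a z != b z.
Proof.
move=> au bbz lk; split; apply: contraTneq lk => eq_z.
  by have [l1 l2] := fix_lt u bA eq_z; rewrite /parity_link l1 l2 !eqxx.
have mA : a * b \in A by rewrite groupM.
have := @fix_lt _ u z mA; rewrite !permM au eq_z bbz => -[] // l1 l2.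
by rewrite /parity_link l1 l2 !eqxx.
Qed.

Lemma card_orb_linked u z : a u = u -> b (b z) = z -> parity_link u z ->
  2 <= #|orb z| /\ (a z != z -> 4 <= #|orb z|).
Proof.
move=> au bbz lk; have [bz az_bz] := parity_link_moved au bbz lk.
split=> [|az]; first exact: card_orb_moved bz.
apply: (@card_orb_ge [:: 1; b; a; a * b]).
  by apply/allP; rewrite /= group1 aA bA !groupM.
have baz : b (a z) != z by rewrite -(inj_eq (@perm_inj _ b)) -!abC bbz.
rewrite /= !permM perm1 !inE /= !negb_or !(eq_sym z) bz az baz.
rewrite (inj_eq perm_inj) eq_sym az_bz eq_sym az -abC (inj_eq perm_inj).
by rewrite eq_sym bz.
Qed.

Hypothesis genA : A = <[a]> * <[b]> :> {set {perm P}}.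
Hypothesis a_fixM : forall x, b (b x) != x -> a x = x.
Variable w : P.
Hypothesis aw : a w != w.

Lemma orb_iterE x y : y \in orb x -> exists i j, y = iter j b (iter i a x).
Proof.
case/orbitP=> g; rewrite genA => /mulsgP[_ _ /cycleP[i ->] /cycleP[j ->] ->] <-.
by exists i, j; rewrite /= /aperm permM !permX.
Qed.

Lemma parity_link_orb u z z' :
    a u = u -> b (b z) = z -> z' \in orb z ->
  b (b z') = z' /\ parity_link u z' = parity_link u z.
Proof.
move=> au bbz /orb_iterE[i [j ->]].
have [bbz1 <-] : b (b (iter i a z)) = iter i a z
    /\ parity_link u (iter i a z) = parity_link u z.
  elim: i => //= i [bbzi <-]; rewrite -!abC bbzi; split=> //.
  have abu : a (b u) = b u by rewrite abC au.
  have [l1 l2] := fix_lt (iter i a z) aA au.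
  by have [l3 l4] := fix_lt (iter i a z) aA abu; rewrite /parity_link l1 l2 l3 l4.
move: (iter i a z) bbz1 => {}z1 bbz1; elim: j => //= j [bbzj <-].
rewrite bbzj; split=> //.
rewrite /parity_link !(poset_aut_lt _ _ bA).
rewrite -[(u < b _)%O](poset_aut_lt _ _ bA) -[(b _ < u)%O](poset_aut_lt _ _ bA) bbzj.
by congr (~~ _ || ~~ _); rewrite eq_sym.
Qed.

(** Suppose z sees the parity of the cycle of x, and z' that of y. If z and z' lay in
different orbits, then these orbits, the two 4-cycles and the orbit of w would
have at least 14 points: either one of z and z' is moved by a and has an orbit of
size 4, or w lies in a further orbit. So z sees the parity of both cycles. If z
is below some x_i then it is below x_i's upper bounds y_j, which are of both
parities, so below all of y's cycle and not linked to it; dually z is not above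
any y_j. Hence x_i < z < y_j, and also z < y_(j+2), for some i and j, although
y_j and y_(j+2) are never both above x_i. *)
Lemma not_both_linked x y :
    b (b x) != x -> b (b y) != y -> (x < y)%O ->
    (forall j, (x < iter j.+2 b y)%O = ~~ (x < iter j b y)%O) ->
  linked x -> linked y -> False.
Proof.
move=> bbx bby lt_xy alt /existsP[z /andP[/eqP bbz lkx]].
case/existsP=> z' /andP[/eqP bbz' lky'].
have b2A : b * b \in A by rewrite groupM.
have disjM u v : b (b u) != u -> b (b v) = v -> u \notin orb v.
  by move=> bbu bbv; have [] := @notin_orb_fix (b * b) u v; rewrite ?permM ?bbv.
have bbw : b (b w) = w by apply: contraTeq aw => /a_fixM ->; rewrite eqxx.
have xy : x \notin orb y by rewrite orbit_sym (lt_notin_orb lt_xy).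
have [o2z o4z] := card_orb_linked (a_fixM bbx) bbz lkx.
have [o2z' o4z'] := card_orb_linked (a_fixM bby) bbz' lky'.
have [o4x o4y] := (card_orb_cycle4 bbx, card_orb_cycle4 bby).
have zz' : z' \in orb z.
  rewrite orbit_sym; apply/negPn/negP => zz'.
  have U4 : uniq (map orb [:: x; y; z; z']).
    by rewrite /= !inE !orb_eqE !negb_or xy zz' !disjM.
  have [az | az] := boolP (a z == z); last first.
    have := @orbit_sizes_le13 [:: x; y; z; z'] [:: 4; 4; 4; 2].
    by rewrite /= o4x o4y o4z // o2z' => /(_ isT U4).
  have [az' | az'] := boolP (a z' == z'); last first.
    have := @orbit_sizes_le13 [:: x; y; z; z'] [:: 4; 4; 2; 4].
    by rewrite /= o4x o4y o2z o4z' // => /(_ isT U4).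
  have [wz zw] := notin_orb_fix aA aw az.
  have [wz' z'w] := notin_orb_fix aA aw az'.
  have := @orbit_sizes_le13 [:: x; y; z; z'; w] [:: 4; 4; 2; 2; 2].
  rewrite /= o4x o4y o2z o2z' (card_orb_moved aA aw) => /(_ isT).
  by rewrite /= !inE !orb_eqE !negb_or xy zz' zw z'w !disjM // => /(_ isT).
have [_] := parity_link_orb (a_fixM bby) bbz zz'; rewrite lky' => /esym lky.
have alt_ij i j : (iter i b x < iter j.+2 b y)%O = ~~ (iter i b x < iter j b y)%O.
  by rewrite !lt_iter !addSn alt.
have z_below u : parity_link u z ->
    (exists i, (iter i b u < z)%O) \/ (exists i, (z < iter i b u)%O).
  rewrite /parity_link.
  case: (boolP (b u < z)%O) => [bu_z _|_]; first by left; exists 1%N.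
  case: (boolP (u < z)%O) => [u_z _|_]; first by left; exists 0%N.
  case: (boolP (z < b u)%O) => [z_bu _|_]; first by right; exists 1%N.
  by case: (boolP (z < u)%O) => [z_u _|_ //]; right; exists 0%N.
case: (z_below x lkx) => [[i x_z] | [i z_x]].
  case: (z_below y lky) => [[j y_z] | [j z_y]].
    have x_z_all (k : nat) : (iter k b x < z)%O.
      case/boolP: (iter k b x < iter j b y)%O => [/lt_trans|]; first exact.
      rewrite -alt_ij => /lt_trans; apply.
      by have [-> _] := @lt_fix_parity j.+2 j y z (negbK _) bbz.
    move: lkx; rewrite /parity_link (x_z_all 0%N) (x_z_all 1%N) eqxx /=.
    by rewrite (lt_gtF (x_z_all 0%N)) (lt_gtF (x_z_all 1%N)).
  have z_y2 : (z < iter j.+2 b y)%O.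
    by have [_ ->] := @lt_fix_parity j.+2 j y z (negbK _) bbz.
  by have := lt_trans x_z z_y2; rewrite alt_ij (lt_trans x_z z_y).
have z_y_all (k : nat) : (z < iter k b y)%O.
  case/boolP: (iter i b x < iter k b y)%O => [|]; first exact: lt_trans.
  rewrite -alt_ij => /(lt_trans z_x).
  by have [_ ->] := @lt_fix_parity k.+2 k y z (negbK _) bbz.
move: lky; rewrite /parity_link (z_y_all 0%N) (z_y_all 1%N) eqxx orbF.
by rewrite (lt_gtF (z_y_all 0%N)) (lt_gtF (z_y_all 1%N)).
Qed.

(** With S the set of j such that x < b^j y, where 0 is in S and 2 is not, the only
question is which of 1 and 3 belong to S. If both or neither do, S is symmetric
under j -> - j; otherwise it is {0, c} with c = 1 or c = 3, and symmetric under
j -> c - j. *)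
Lemma fixed_cycles_absurd v : b (b v) != v -> False.
Proof.
move=> bbv.
have [x [y [bbx bby lt_xy nlt_bbxy]]] := exists_comparable_cycles bbv.
have xy : x \notin orb y by rewrite orbit_sym (lt_notin_orb lt_xy).
have coverM z : b (b z) != z -> exists i, z = iter i b x \/ z = iter i b y.
  have orbM u : b (b u) != u -> z \in orb u -> exists i, z = iter i b u.
    move=> bbu /orb_iterE[i [j ->]]; exists j; congr iter.
    by rewrite iter_fix // a_fixM.
  move=> bbz; have [/(orbM _ bbx)[i ->]|zx] := boolP (z \in orb x).
    by exists i; left.
  have [/(orbM _ bby)[i ->]|zy] := boolP (z \in orb y).
    by exists i; right.
  have afix u : b (b u) != u -> u \notin orb w.
    move=> bbu; have au : a u == u by rewrite a_fixM.
    by have [] := notin_orb_fix aA aw au.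
  have := @orbit_sizes_le13 [:: x; y; z; w] [:: 4; 4; 4; 2].
  rewrite /= !card_orb_cycle4 // (card_orb_moved aA aw) => /(_ isT).
  rewrite /= !inE !orb_eqE !negb_or xy (orbit_sym _ _ x z) (orbit_sym _ _ y z).
  rewrite zx zy !afix //.
  by move=> /(_ isT).
pose S j := (x < iter j b y)%O.
have [s1 [s3 SE]] : exists s1 s3 : bool, forall j,
    S j = nth false [:: true; s1; false; s3] (j %% 4).
  exists (S 1%N), (S 3) => j; rewrite /S -iter_mod4.
  have := ltn_pmod j (isT : 0 < 4).
  by case: (j %% 4) => [|[|[|[|//]]]] _ //=; rewrite -lt_bb; apply: negbTE.
have symS c : (forall i, i < 4 -> nth false [:: true; s1; false; s3] i =
      nth false [:: true; s1; false; s3] ((c + 3 * i) %% 4)) ->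
    forall j, S j = S (c + 3 * j).
  move=> Sc j; rewrite !SE Sc ?ltn_pmod //.
  by rewrite -[in RHS]modnDmr -[in RHS]modnMmr modnDmr.
have [s13 | s13] := eqVneq s1 s3.
  apply: (@reflection_absurd 0 0 x y) => //.
  by apply: (symS 0%N); rewrite s13 => -[|[|[|[|//]]]].
have alt j : S j.+2 = ~~ S j.
  rewrite !SE -addn2 -modnDml; have := ltn_pmod j (isT : 0 < 4).
  by case: (j %% 4) s1 s3 s13 {SE symS} => [|[|[|[|m]]]] [] [] //=.
have unl : ~~ linked x || ~~ linked y.
  rewrite -negb_and; apply/negP => /andP[].
  exact: not_both_linked bbx bby lt_xy alt.
(* The shifts (e, f) satisfy f - e = c mod 4, and the odd one belongs to an
   unlinked cycle. *)
case: s1 s3 s13 {SE} symS => [] [] // _ symS; case/orP: unl => unl.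
- apply: (@reflection_absurd 1 2 x y) => //.
  by apply: (symS 5) => -[|[|[|[|//]]]].
- apply: (@reflection_absurd 0 1 x y) => //.
  by apply: (symS 1%N) => -[|[|[|[|//]]]].
- apply: (@reflection_absurd 1 0 x y) => //.
  by apply: (symS 3) => -[|[|[|[|//]]]].
- apply: (@reflection_absurd 0 3 x y) => //.
  by apply: (symS 3) => -[|[|[|[|//]]]].
Qed.

End PosetAutomorphisms.

(** * The lower bound *)

Lemma abelian_aut_card_ge14 d (P : finPOrderType d) (a b : {perm P}) :
    abelian (poset_aut P) -> poset_aut P = <[a]> * <[b]> :> {set {perm P}} ->
    a * a = 1 -> b ^+ 4 = 1 -> a != 1 -> b * b != 1 -> a * (b * b) != 1 ->
  14 <= #|P|.
Proof.
move=> abA genA a2 b4 an1 b2n1 ab2n1; rewrite leqNgt; apply/negP => le13.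
have aA : a \in poset_aut P.
  by rewrite genA -[X in X \in _]mulg1 mem_mulg ?cycle_id ?group1.
have bA : b \in poset_aut P.
  by rewrite genA -[X in X \in _]mul1g mem_mulg ?cycle_id ?group1.
have a2E x : a (a x) = x by rewrite -permM a2 perm1.
have b4E x : b (b (b (b x))) = x by rewrite -[RHS](perm1 x) -b4 !expgS !permM perm1.
have moved (g : {perm P}) : g != 1 -> exists x, g x != x.
  move=> gn1; apply/existsP; apply: contraR gn1; rewrite negb_exists.
  by move/forallP=> gx; apply/eqP/permP => x; rewrite perm1; apply/eqP/negPn.
have [v] := moved _ b2n1; rewrite permM => bbv.
have [w1 aw1] := moved _ an1; have [w2 abbw2] := moved _ ab2n1.
have typeM := no_regular_orbit abA aA bA a2E b4E le13.
case/orP: (typeM v bbv) => [/eqP av | /eqP av].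
  apply: (fixed_cycles_absurd abA aA bA b4E le13 genA (w := w1) _ aw1 bbv) => x bbx.
  case/orP: (typeM x bbx) => [/eqP // | /eqP ax].
  by case: (stabilizer_type_unique abA aA bA a2E b4E le13 bbv bbx av ax).
(* All points moved by b^2 have stabilizer <a b^2>, and a b^2 may serve as a. *)
pose a' := a * (b * b).
have a'A : a' \in poset_aut P by rewrite !groupM.
have a'K : a' * (b * b) = a by rewrite -[RHS]mulg1 -b4 /a' !expgS expg0 mulg1 !mulgA.
have a'2E x : a' (a' x) = x.
  by rewrite !permM -!(abC abA aA bA) b4E a2E.
have genA' : poset_aut P = <[a']> * <[b]> :> {set {perm P}}.
  have sa'A : <[a']> \subset poset_aut P by rewrite cycle_subG.
  have sbA : <[b]> \subset poset_aut P by rewrite cycle_subG.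
  rewrite -cent_joinEr ?(sub_abelian_cent2 abA) //.
  have a'J : a' \in <[a']> <*> <[b]> by rewrite mem_gen // inE cycle_id.
  have bJ : b \in <[a']> <*> <[b]> by rewrite mem_gen // inE cycle_id orbT.
  apply/eqP; rewrite eqEsubset join_subG sa'A sbA !andbT {1}genA.
  apply: mul_subG; rewrite cycle_subG; last exact: bJ.
  by rewrite -[X in X \in _]a'K; apply: groupM a'J (groupM bJ bJ).
apply: (fixed_cycles_absurd abA a'A bA b4E le13 genA' (w := w2) _ _ bbv).
  move=> x bbx; case/orP: (typeM x bbx) => /eqP ax.
    by case: (stabilizer_type_unique abA aA bA a2E b4E le13 bbx bbv ax av).
  by rewrite !permM ax b4E.
by [].
Qed.

(** * A poset with 14 points *)

(** inl (l, i) is the i-th point of level l: x_i, y_i, z_i for l = 0, 1, 2. The two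
points inr j are on top. *)
Definition poset14 := ('I_3 * 'Z_4 + 'Z_2)%type.
HB.instance Definition _ := Finite.on poset14.

Definition poset14_le (u v : poset14) : bool :=
  match u, v with
  | inl (l, i), inl (m, j) =>
      (i == j) && (l <= m) || [&& l == 0 :> nat, m == 2 :> nat & j == (i + 1)%R]
  | inl _, inr _ => true
  | inr _, inl _ => false
  | inr i, inr j => i == j
  end.

Lemma poset14_le_refl : reflexive poset14_le.
Proof. by case=> [[l i]|j] /=; rewrite !eqxx // leqnn. Qed.

Lemma poset14_le_anti : antisymmetric poset14_le.
Proof.
case=> [[l i]|i] [[m j]|j] //=; last by case/andP=> /eqP->.
case/andP=> /orP[/andP[/eqP-> le_lm] | /and3P[/eqP l0 /eqP m2 _]].
  case/orP=> [/andP[_ le_ml] | /and3P[/eqP m0 /eqP l2 _]].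
    by congr (inl (_, _)); apply: val_inj; apply/eqP; rewrite eqn_leq le_lm.
  by rewrite m0 l2 in le_lm.
by rewrite l0 m2 andbF.
Qed.

Lemma poset14_le_trans : transitive poset14_le.
Proof.
move=> [[m j]|j] [[l i]|i] [[n k]|k] //=; last by move=> /eqP->.
case/orP=> [/andP[/eqP-> le_lm] | /and3P[-> /eqP m2 /eqP->]].
  case/orP=> [/andP[/eqP-> le_mn] | /and3P[/eqP m0 -> ->]].
    by rewrite eqxx (leq_trans le_lm).
  by move: le_lm; rewrite m0 leqn0 => ->; rewrite orbT.
rewrite m2; case/orP=> [/andP[/eqP-> le2n] | /and3P[//]].
have -> : n == 2 :> nat by rewrite eqn_leq le2n -ltnS ltn_ord.
by rewrite eqxx orbT.
Qed.

Fact poset14_display : Order.disp_t. Proof. exact: Order.Disp tt tt. Qed.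
HB.instance Definition _ :=
  Order.Le_isPOrder.Build poset14_display poset14
    poset14_le_refl poset14_le_anti poset14_le_trans.

Lemma poset14_leE (u v : poset14) : (u <= v)%O = poset14_le u v.
Proof. by []. Qed.

Lemma card_poset14 : #|{: poset14}| = 14.
Proof. by rewrite card_sum card_prod !card_ord. Qed.

Definition shift (g : 'Z_2 * 'Z_4) (u : poset14) : poset14 :=
  match u with
  | inl (l, i) => inl (l, (i + g.2)%R)
  | inr j => inr (j + g.1)%R
  end.

Lemma shift_inj g : injective (shift g).
Proof.
apply: (can_inj (g := shift (- g.1, - g.2)%R)) => -[[l i]|j] /=.
  by rewrite GRing.addrK.
by rewrite GRing.addrK.
Qed.

Definition shift_perm g := perm (@shift_inj g).

Lemma shift_permM : {in [set: 'Z_2 * 'Z_4] &, {morph shift_perm : g h / g * h}}.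
Proof.
move=> g h _ _; apply/permP => u; rewrite permM !permE.
by case: u => [[l i]|j] /=; rewrite GRing.addrA.
Qed.

Canonical shift_morphism := Morphism shift_permM.

Lemma shift_perm_inj : injective shift_perm.
Proof.
move=> [s t] [s' t'] /permP eq_g.
have := eq_g (inl (ord0, 0%R)); have := eq_g (inr 0%R); rewrite !permE /=.
by rewrite !GRing.add0r => -[->] [->].
Qed.

Lemma shift_perm_aut g : shift_perm g \in poset_aut poset14.
Proof.
have le_shift u v : (shift g u <= shift g v)%O = (u <= v)%O.
  rewrite !poset14_leE; case: u v => [[l i]|i] [[m j]|j] //=.
    by rewrite GRing.addrAC !(inj_eq (GRing.addIr _)).
  by rewrite (inj_eq (GRing.addIr _)).
apply: mem_poset_aut => u v; rewrite !permE.
by rewrite !lt_neqAle le_shift (inj_eq (@shift_inj g)).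
Qed.

Definition height (u : poset14) : nat := if u is inl (l, _) then l else 3.

Lemma height_lt u v : (u < v)%O -> height u < height v.
Proof.
rewrite lt_neqAle poset14_leE.
case: u v => [[l i]|i] [[m j]|j] //=;
  last by case/andP=> /eqP ne /eqP eq_ij; rewrite eq_ij in ne.
case/andP=> ne /orP[/andP[/eqP eq_ij le_lm] | /and3P[/eqP-> /eqP-> //]].
rewrite ltn_neqAle le_lm andbT; apply: contra ne => /eqP eq_lm.
by rewrite eq_ij (val_inj eq_lm).
Qed.

Lemma height_le u : height u <= 3.
Proof. by case: u => [[l i]|j] //=; rewrite ltnW. Qed.

Lemma chain4_levels m n p q : m < n -> n < p -> p < q -> q <= 3 ->
  [/\ m = 0, n = 1, p = 2 & q = 3]%N.
Proof.
case: q => [|[|[|[|q]]]] //; case: p => [|[|[|p]]] //; case: n => [|[|n]] //.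
by case: m.
Qed.

(** Every point lies on a chain of four points, and automorphisms map it to a
strictly increasing chain, along which the height can only be 0, 1, 2, 3. *)
Lemma height_aut s u : s \in poset_aut poset14 -> height (s u) = height u.
Proof.
move=> sA.
have lt_level (l m : 'I_3) i : l < m -> (inl (l, i) < inl (m, i) :> poset14)%O.
  move=> lt_lm; rewrite lt_neqAle poset14_leE.
  apply/andP; split; last by rewrite /= eqxx ltnW.
  by apply: contraTneq lt_lm => -[->]; rewrite ltnn.
have chain i j : [/\ height (s (inl (Ordinal (isT : 0 < 3), i))) = 0%N,
    height (s (inl (Ordinal (isT : 1 < 3), i))) = 1%N,
    height (s (inl (Ordinal (isT : 2 < 3), i))) = 2 & height (s (inr j)) = 3].
  have up p q : (p < q)%O -> height (s p) < height (s q).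
    by rewrite -(poset_aut_lt _ _ sA); apply: height_lt.
  have h01 := up _ _ (lt_level (Ordinal (isT : 0 < 3)) (Ordinal (isT : 1 < 3)) i isT).
  have h12 := up _ _ (lt_level (Ordinal (isT : 1 < 3)) (Ordinal (isT : 2 < 3)) i isT).
  have h23 := up (inl (Ordinal (isT : 2 < 3), i)) (inr j) isT.
  exact: chain4_levels h01 h12 h23 (height_le _).
case: u => [[l i]|j]; last by have [_ _ _ ->] := chain 0%R j.
have [h0 h1 h2 _] := chain i 0%R.
case: l => [[|[|[|//]]] lt_l] /=.
- by rewrite -[RHS]h0; congr (height (s (inl (_, _)))); apply: val_inj.
- by rewrite -[RHS]h1; congr (height (s (inl (_, _)))); apply: val_inj.
- by rewrite -[RHS]h2; congr (height (s (inl (_, _)))); apply: val_inj.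
Qed.

Lemma Z4_ind (Q : 'Z_4 -> Prop) :
  Q 0%R -> (forall i, Q i -> Q (i + 1)%R) -> forall i, Q i.
Proof.
move=> Q0 QS i; rewrite -[i]natr_Zp; elim: (i : nat) => // n Qn.
by rewrite GRing.mulrSr; apply: QS.
Qed.

(** If s maps x_i to x_j, then it maps y_i to y_j and z_i to z_j, as x_i < y_i < z_i.
Now x_i < z_(i+1) shows that x_(i+1) goes to x_j or to x_(j+1); the first is
taken by x_i. *)
Lemma poset14_autE s : s \in poset_aut poset14 -> exists g, s = shift_perm g.
Proof.
move=> sA.
have level (l : 'I_3) i : exists j, s (inl (l, i)) = inl (l, j).
  have := height_aut (inl (l, i)) sA.
  case: (s _) => [[m j]|j] /= eq_lm; first by exists j; rewrite (val_inj eq_lm).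
  by have := ltn_ord l; rewrite -eq_lm.
have top j : exists k, s (inr j) = inr k.
  have := height_aut (inr j) sA; case: (s _) => [[m i]|k] /= eq_lm; last by exists k.
  by have := ltn_ord m; rewrite eq_lm.
have le_s u v : (s u <= s v)%O = (u <= v)%O.
  by rewrite !le_eqVlt poset_aut_lt // (inj_eq perm_inj).
pose l0 := Ordinal (isT : 0 < 3); pose l1 := Ordinal (isT : 1 < 3).
pose l2 := Ordinal (isT : 2 < 3).
have [t st] := level l0 0%R; have [r sr] := top 0%R.
have up i j : s (inl (l0, i)) = inl (l0, j) ->
    s (inl (l1, i)) = inl (l1, j) /\ s (inl (l2, i)) = inl (l2, j).
  move=> s0.
  have [j1 s1] := level l1 i; have [j2 s2] := level l2 i.
  have le01 : (s (inl (l0, i)) <= s (inl (l1, i)))%O.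
    by rewrite le_s poset14_leE /= eqxx.
  have le12 : (s (inl (l1, i)) <= s (inl (l2, i)))%O.
    by rewrite le_s poset14_leE /= eqxx.
  move: le01 le12; rewrite s0 s1 s2 !poset14_leE /= !andbT !orbF.
  by move=> /eqP <- /eqP <-.
have s0 i : s (inl (l0, i)) = inl (l0, (i + t)%R).
  elim/Z4_ind: i => [|i s0i]; first by rewrite GRing.add0r.
  have [j s0j] := level l0 (i + 1)%R.
  have [_ s2j] := up _ _ s0j.
  have : (s (inl (l0, i)) <= s (inl (l2, (i + 1)%R)))%O.
    by rewrite le_s poset14_leE /= !eqxx orbT.
  rewrite s0i s2j poset14_leE /= andbT => /orP[] /eqP eq_j.
    have : s (inl (l0, i)) = s (inl (l0, (i + 1)%R)) by rewrite s0i s0j eq_j.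
    move/perm_inj/(congr1 (fun u => if u is inl (_, k) then k else i)) => /= /eqP.
    by rewrite -[X in X == _]GRing.addr0 (inj_eq (GRing.addrI _)).
  by rewrite s0j eq_j GRing.addrAC.
exists (r, t); apply/permP => -[[l i]|j]; rewrite permE /=.
  have [s1 s2] := up _ _ (s0 i).
  case: l => [[|[|[|//]]] lt_l].
  - by rewrite (_ : Ordinal lt_l = l0) ?s0 //; apply: val_inj.
  - by rewrite (_ : Ordinal lt_l = l1) ?s1 //; apply: val_inj.
  - by rewrite (_ : Ordinal lt_l = l2) ?s2 //; apply: val_inj.
have [-> | j_neq0] := eqVneq j 0%R; first by rewrite sr GRing.add0r.
have [k sk] := top j; rewrite sk; congr inr.
have: k != r.
  by apply: contraNneq j_neq0 => eq_kr; move: sk; rewrite eq_kr -sr => /perm_inj[->].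
(* In Z_2, differing from r means being 1 + r. *)
case: j k r j_neq0 {sk sr} => [[|[|//]] ?] [[|[|//]] ?] [[|[|//]] ?] //= _ _;
  exact: val_inj.
Qed.

Lemma poset14_aut_isog : poset_aut poset14 \isog [set: 'Z_2 * 'Z_4].
Proof.
rewrite isog_sym; apply/isogP; exists [morphism of shift_perm].
  by apply/injmP => g h _ _; apply: shift_perm_inj.
apply/setP => s; apply/imsetP/idP => [[g _ ->]|]; first exact: shift_perm_aut.
by case/poset14_autE=> g ->; exists g; rewrite ?inE.
Qed.

(** * The value of beta *)

Lemma Z2xZ4_gen (u v : 'Z_2 * 'Z_4) : u = (1, 0)%R -> v = (0, 1)%R ->
  [set: 'Z_2 * 'Z_4] = <[u]> * <[v]>.
Proof.
move=> uE vE; apply/setP => -[s t]; rewrite inE; apply/esym/mulsgP.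
exists (u ^+ s) (v ^+ t); rewrite ?mem_cycle // uE vE.
by case: s t => [[|[|//]] ?] [[|[|[|[|//]]]] ?]; congr (_, _); apply: val_inj.
Qed.

Lemma isog_Z2xZ4_card_ge14 d (P : finPOrderType d) :
  poset_aut P \isog [set: 'Z_2 * 'Z_4] -> 14 <= #|P|.
Proof.
rewrite isog_sym => /isogP[f injf fT].
have abZ : abelian [set: 'Z_2 * 'Z_4].
  by apply/centsP => g _ h _; congr (_, _); apply: GRing.addrC.
pose u : 'Z_2 * 'Z_4 := (1, 0)%R; pose v : 'Z_2 * 'Z_4 := (0, 1)%R.
have neq1 g : g != 1 -> f g != 1 by rewrite morph_injm_eq1 ?inE.
apply: (@abelian_aut_card_ge14 d P (f u) (f v)).
- by rewrite -fT morphim_abelian.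
- have genT : [set: 'Z_2 * 'Z_4] = <[u]> * <[v]> by apply: Z2xZ4_gen.
  have := congr1 (fun B => f @* B) genT; rewrite morphimMl ?subsetT //.
  by rewrite !morphim_cycle ?inE // => <-; rewrite -[LHS]fT.
- by rewrite -morphM ?inE // (_ : u * u = 1) ?morph1 //; congr (_, _); apply: val_inj.
- by rewrite -morphX ?inE // (_ : v ^+ 4 = 1) ?morph1 //; congr (_, _); apply: val_inj.
- exact: neq1.
- by rewrite -morphM ?inE //; apply: neq1.
- by rewrite -!morphM ?inE //; apply: neq1.
Qed.

Theorem theorem1p1 : beta [set: 'Z_2 * 'Z_4]%G = 14.
Proof.
apply/betaE => //; split=> [|_ [d [P [_ isoP ->]]]].
  exists poset14_display, poset14; split; rewrite ?card_poset14 //.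
  exact: poset14_aut_isog.
exact: isog_Z2xZ4_card_ge14.
Qed.
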